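(* Let $(A,B,\boldsymbol{c})$ be a positive $d$-dimensional instance of the Discrete Polytope Escape Problem with $A\in\mathbb{Q}^{d\times d}$, $B\in\mathbb{Q}^{n\times d}$, $\boldsymbol{c}\in\mathbb{Q}^n$, where the rational numbers use at most $b\in\mathbb{N}$ bits and the polytope $\mathcal{P}_{B,\boldsymbol{c}}$ is compact, and let $\boldsymbol{x}_0$ be an initial point. Then for $N=e^{bd^{O(d)}}$ we have $\boldsymbol{x}_N\notin\mathcal{P}_{B,\boldsymbol{c}}$, where $\boldsymbol{x}_N=A^N\boldsymbol{x}_0$.
   Context: A $d$-dimensional instance of the Discrete Polytope Escape Problem (DPEP) is a triple $(A,B,\boldsymbol{c})$ representing the recurrence $\boldsymbol{x}_{m+1}=A\boldsymbol{x}_m$ on $\mathbb{R}^d$ and the polytope $\mathcal{P}_{B,\boldsymbol{c}}=\{\boldsymbol{x}\in\mathbb{R}^d\mid B\boldsymbol{x}\le\boldsymbol{c}\}$ (componentwise inequality). Initial points are points $\boldsymbol{x}_0\in\mathcal{P}_{B,\boldsymbol{c}}$. The instance is positive if every sequence escapes: for every $\boldsymbol{x}_0\in\mathcal{P}_{B,\boldsymbol{c}}$ there is $m\in\mathbb{N}$ with $A^m\boldsymbol{x}_0\notin\mathcal{P}_{B,\boldsymbol{c}}$. *)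

(* Defs.v *)
From HB Require Import structures.
From mathcomp Require Import all_boot all_order all_algebra.
From mathcomp Require Import all_classical all_reals all_analysis.

Set Implicit Arguments.
Unset Strict Implicit.
Unset Printing Implicit Defensive.

Import Order.TTheory GRing.Theory Num.Theory.
Import numFieldNormedType.Exports.
Local Open Scope classical_set_scope.
Local Open Scope ring_scope.

Definition polytope (R : realType) (d n : nat)
    (B : 'M[R]_(n, d)) (c : 'cV[R]_n) : set 'cV[R]_d :=
  [set x | forall i : 'I_n, (B *m x) i 0 <= c i 0].

Definition dpep_positive (R : realType) (d n : nat)
    (A : 'M[R]_d) (B : 'M[R]_(n, d)) (c : 'cV[R]_n) : Prop :=
  forall x0 : 'cV[R]_d, polytope B c x0 ->
    exists m : nat, ~ polytope B c (A ^+ m *m x0).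

(* Binary length of p / q in lowest terms: a sign bit, then
   ceil(log2(|p| + 1)) bits for p and ceil(log2(q + 1)) bits for q. *)
Definition rat_bits (r : rat) : nat :=
  (1 + up_log 2 `|numq r|.+1 + up_log 2 `|denq r|.+1)%N.

(* The bound is on each entry separately, not on their total length. *)
Definition entries_bits_le (m n : nat) (M : 'M[rat]_(m, n)) (b : nat) : Prop :=
  forall i j, (rat_bits (M i j) <= b)%N.

(* Main.v *)
(* If the first N + 1 points of the orbit of x0 stay in the polytope P, then by
   convexity the average y of the first N of them is in P, and
   A y - y = (A^N x0 - x0) / N is small because P is bounded.  Fourier-Motzkin
   elimination on integer rows squares (and doubles) the height at each step, so
   a rational system with a parameter delta that is feasible for some delta
   below a doubly exponentially small threshold is feasible at delta = 0.
   Hence, for N above the inverse of the threshold, A has a fixed point in P,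
   contradicting positivity.  For d >= 2 the factor d^(C d) in the exponent
   absorbs the cost 8^d of eliminating 3 d variables. *)
Require Import Defs.
From HB Require Import structures.
From mathcomp Require Import all_boot all_order all_algebra.
From mathcomp Require Import all_classical all_reals all_analysis.
From mathcomp Require Import ring lra zify.

Set Implicit Arguments.
Unset Strict Implicit.
Unset Printing Implicit Defensive.

Import Order.TTheory GRing.Theory Num.Theory.
Import numFieldNormedType.Exports.
Local Open Scope classical_set_scope.
Local Open Scope ring_scope.

(** * Fourier-Motzkin elimination with control of heights *)

(** Rows with [0 < a i] bound [t] above by [h i / a i], rows with [a j < 0] bound it below by
    [h j / a j]; the second hypothesis, divided by [a i * a j < 0], puts every lower bound below
    every upper one. The least upper bound, or else the greatest lower bound, or else 0, is then a
    valid [t]. *)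
Lemma eliminate_variable (R : realFieldType) (I : finType) (a h : I -> R) :
  (forall i, a i = 0 -> 0 <= h i) ->
  (forall i j, 0 < a i -> a j < 0 -> 0 <= a i * h j - a j * h i) ->
  exists t, forall i, a i * t <= h i.
Proof.
move=> h0 hpn.
have solve t : (forall i, 0 < a i -> t <= h i / a i) ->
    (forall j, a j < 0 -> h j / a j <= t) -> forall i, a i * t <= h i.
  move=> tU tL i; have [ai|ai|ai] := ltgtP (a i) 0.
  - by have := tL _ ai; rewrite ler_ndivrMr // mulrC.
  - by have := tU _ ai; rewrite ler_pdivlMr // mulrC.
  - by rewrite ai mul0r h0.
have [[i0 ai0]|noU] := pselect (exists i, 0 < a i).
  exists (\big[Num.min/h i0 / a i0]_(i | 0 < a i) (h i / a i)).
  apply: solve => [i ai|j aj]; first exact: bigmin_le_cond.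
  have le_pn i : 0 < a i -> h j / a j <= h i / a i.
    move=> ai; rewrite ler_ndivrMr // mulrAC ler_pdivrMr //.
    by rewrite -subr_ge0 mulrC [_ * a j]mulrC hpn.
  by apply/bigmin_geP; split=> [|i ai]; apply: le_pn.
have [[j0 aj0]|noL] := pselect (exists j, a j < 0).
  exists (\big[Num.max/h j0 / a j0]_(j | a j < 0) (h j / a j)).
  apply: solve => [i ai|j aj]; first by case: noU; exists i.
  exact: le_bigmax_cond.
exists 0; apply: solve => [i ai|j aj]; first by case: noU; exists i.
by case: noL; exists j.
Qed.

Lemma normz_le_combination (p q x y : int) (H : nat) :
  (`|p| <= H)%N -> (`|q| <= H)%N -> (`|x| <= H)%N -> (`|y| <= H)%N ->
  (`|(p * y - q * x)%R| <= 2 * H ^ 2)%N.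
Proof.
move=> pH qH xH yH.
have : (`|(p * y)%R| <= H ^ 2)%N by rewrite abszM -mulnn leq_mul.
have : (`|(q * x)%R| <= H ^ 2)%N by rewrite abszM -mulnn leq_mul.
by lia.
Qed.

(** Induction on the number of variables; each elimination turns the height [H] into [2 * H ^ 2].
    With no variable left, a row reads [0 <= c i + delta * e i] with [delta * e i < 1], so the
    integer [c i] exceeds -1 and is nonnegative. *)
Lemma feasible_at0_int (R : realFieldType) (k : nat) (I : finType)
    (a : I -> 'I_k -> int) (c e : I -> int) (H : nat) (delta : R)
    (x : 'I_k -> R) :
  (forall i l, `|a i l| <= H)%N -> (forall i, `|c i| <= H)%N ->
  (forall i, `|e i| <= H)%N ->
  0 <= delta -> (iter k (fun H => 2 * H ^ 2) H)%N%:R * delta < 1 ->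
  (forall i, \sum_l (a i l)%:~R * x l <= (c i)%:~R + delta * (e i)%:~R) ->
  exists x', forall i, \sum_l (a i l)%:~R * x' l <= (c i)%:~R :> R.
Proof.
elim: k I a c e H x => [|k IHk] I a c e H x aH cH eH delta0.
  rewrite /= => Hdelta sys; exists x => i.
  have := sys i; rewrite !big_ord0 => ce0.
  suff : -1 < (c i)%:~R :> R by rewrite -[-1]/((-1)%:~R) ltr_int ler0z; lia.
  have : (e i)%:~R * delta <= H%:R * delta.
    rewrite ler_wpM2r // (le_trans (ler_norm _)) // -intr_norm.
    by rewrite -[H%:R]/(H%:Z%:~R) ler_int; have := eH i; lia.
  by rewrite mulrC; lra.
rewrite iterSr => Hdelta sys.
pose up i := a i ord0.
pose J := (I + I * I)%type.
(* Indices that give no eliminated row get the trivial row [0 <= 0], so that the new system is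
   indexed by the whole of [J]. *)
pose comb (f : I -> int) (j : J) : int :=
  match j with
  | inl i => if up i == 0 then f i else 0
  | inr (i, j) => if (0 < up i) && (up j < 0) then up i * f j - up j * f i
                  else 0
  end.
have combH f : (forall i, `|f i| <= H)%N ->
    forall j, (`|comb f j| <= 2 * H ^ 2)%N.
  move=> fH [i|[i j]] /=; case: ifP => _ //; last first.
    by apply: normz_le_combination => //; apply: aH.
  by apply: leq_trans (fH i) _; nia.
pose tl (l : 'I_k) := lift ord0 l.
(* The slack of a combined row is the same combination of the old slacks. This serves twice: at
   [g = delta] to pass feasibility down, at [g = 0] to lift the solution back. *)
have combE (g : R) (z : 'I_k -> R) (j : J) :
  (comb c j)%:~R + g * (comb e j)%:~R
     - \sum_l (comb (a^~ (tl l)) j)%:~R * z l =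
  let h i := (c i)%:~R + g * (e i)%:~R - \sum_l (a i (tl l))%:~R * z l in
  match j with
  | inl i => if up i == 0 then h i else 0
  | inr (i, j) => if (0 < up i) && (up j < 0) then
                     (up i)%:~R * h j - (up j)%:~R * h i
                  else 0
  end.
  case: j => [i|[i j]] /=; case: ifP => _ //.
  - by rewrite mulr0 big1 ?subr0 ?addr0 // => l _; rewrite mul0r.
  - under eq_bigr do rewrite !(intrB, intrM) mulrBl -!mulrA.
    by rewrite sumrB -!mulr_sumr !(intrB, intrM); ring.
  - by rewrite mulr0 big1 ?subr0 ?addr0 // => l _; rewrite mul0r.
have [x' sys'] : exists x' : 'I_k -> R, forall j : J,
    \sum_l (comb (a^~ (tl l)) j)%:~R * x' l <= (comb c j)%:~R.
  apply: (IHk _ _ _ (comb e) (2 * H ^ 2)%N (x \o tl)) => //.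
  - by move=> j l; apply: combH.
  - exact: combH.
  - exact: combH.
  move=> j; rewrite -subr_ge0 combE /=.
  have hx i : (up i)%:~R * x ord0 <= (c i)%:~R + delta * (e i)%:~R
      - \sum_l (a i (tl l))%:~R * x (tl l).
    by have := sys i; rewrite big_ord_recl; rewrite /up /tl; lra.
  case: j => [i|[i j]]; case: ifP => //.
    by move=> /eqP ui; have := hx i; rewrite ui mul0r.
  case/andP; rewrite -(ltr0z R) -(ltrz0 R) => ui uj.
  have := hx i; have := hx j.
  rewrite -(ler_pM2l ui) -(ler_nM2l uj) => ? ?; nra.
pose h i := (c i)%:~R - \sum_l (a i (tl l))%:~R * x' l.
have pos (j : J) : 0 <= (comb c j)%:~R
    - \sum_l (comb (a^~ (tl l)) j)%:~R * x' l :> R by rewrite subr_ge0.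
have hE i : h i = (c i)%:~R + 0 * (e i)%:~R - \sum_l (a i (tl l))%:~R * x' l.
  by rewrite mul0r addr0.
have combE0 j := combE 0 x' j.
have [i ui|i j ui uj|t ht] := @eliminate_variable R I (fun i => (up i)%:~R) h.
- have := pos (inl i); have := combE0 (inl i); rewrite mul0r addr0 => -> /=.
  by move/eqP: ui; rewrite intr_eq0 => ->; rewrite hE => ->.
- have := pos (inr (i, j)); have := combE0 (inr (i, j)).
  rewrite mul0r addr0 => -> /=.
  by move: (ui) (uj); rewrite ltr0z ltrz0 => -> -> /=; rewrite !hE => ->.
exists (fun l => oapp x' t (unlift ord0 l)) => i.
rewrite big_ord_recl unlift_none /=.
under eq_bigr do rewrite liftK /=.
by have := ht i; rewrite /h /up /tl; lra.
Qed.

(** Multiplying row [i] by its own [D > 0] makes it integral of height at most [H] and leaves the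
    solution set and [delta] unchanged. *)
Lemma feasible_at0_rat (R : realFieldType) (V I : finType)
    (a : I -> V -> rat) (c e : I -> rat) (H : nat) (delta : R) (x : V -> R) :
  (forall i, exists2 D : int, 0 < D &
     [/\ forall v, exists2 p : int, (`|p| <= H)%N & D%:~R * a i v = p%:~R,
         exists2 p : int, (`|p| <= H)%N & D%:~R * c i = p%:~R
       & exists2 p : int, (`|p| <= H)%N & D%:~R * e i = p%:~R]) ->
  0 <= delta -> (iter #|V| (fun H => 2 * H ^ 2) H)%N%:R * delta < 1 ->
  (forall i, \sum_v ratr (a i v) * x v <= ratr (c i) + delta * ratr (e i)) ->
  exists x', forall i, \sum_v ratr (a i v) * x' v <= ratr (c i) :> R.
Proof.
move=> scale delta0 Hdelta sys.
have /choice[D HD] : forall i, exists D : int, 0 < D /\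
     [/\ forall v, exists2 p : int, (`|p| <= H)%N & D%:~R * a i v = p%:~R,
         exists2 p : int, (`|p| <= H)%N & D%:~R * c i = p%:~R
       & exists2 p : int, (`|p| <= H)%N & D%:~R * e i = p%:~R].
  by move=> i; have [D D0 ?] := scale i; exists D.
have D_gt0 i : 0 < (D i)%:~R :> R by rewrite ltr0z; case: (HD i).
have ratrD (r : rat) i (p : int) :
    (D i)%:~R * r = p%:~R -> (D i)%:~R * ratr r = p%:~R :> R.
  by move=> eq_p; rewrite -(ratr_int R (D i)) -rmorphM /= eq_p ratr_int.
have /choice[a' Ha'] : forall iv : I * V, exists p : int, (`|p| <= H)%N /\
    (D iv.1)%:~R * ratr (a iv.1 iv.2) = p%:~R :> R.
  by move=> [i v]; have [_ [/(_ v) [p pH /ratrD]]] := HD i; exists p.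
have /choice[c' Hc'] : forall i, exists p : int, (`|p| <= H)%N /\
    (D i)%:~R * ratr (c i) = p%:~R :> R.
  by move=> i; have [_ [_ [p pH /ratrD]]] := HD i; exists p.
have /choice[e' He'] : forall i, exists p : int, (`|p| <= H)%N /\
    (D i)%:~R * ratr (e i) = p%:~R :> R.
  by move=> i; have [_ [_ _ [p pH /ratrD]]] := HD i; exists p.
have sumE (y : V -> R) i :
    \sum_(l < #|V|) (a' (i, enum_val l))%:~R * y (enum_val l) =
    (D i)%:~R * \sum_v ratr (a i v) * y v.
  rewrite mulr_sumr (reindex (@enum_val V V) (onW_bij _ (enum_val_bij V))).
  by apply: eq_bigr => l _; rewrite mulrA (Ha' (i, _)).2.
have [y Hy] : exists y : 'I_#|V| -> R, forall i,
    \sum_l (a' (i, enum_val l))%:~R * y l <= (c' i)%:~R.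
  apply: (@feasible_at0_int R _ I _ c' e' H delta (x \o enum_val)) => //.
  - by move=> i l; exact: (Ha' (_, _)).1.
  - by move=> i; have [] := Hc' i.
  - by move=> i; have [] := He' i.
  move=> i; rewrite /= sumE -(Hc' i).2 -(He' i).2 [delta * _]mulrCA -mulrDr.
  by rewrite ler_pM2l.
exists (y \o enum_rank) => i; rewrite -(ler_pM2l (D_gt0 i)) -sumE (Hc' i).2.
by under eq_bigr do rewrite /= enum_valK.
Qed.

(** * Bit lengths and common denominators *)

Lemma rat_bits_split (r : rat) (b : nat) : (rat_bits r <= b)%N ->
  exists i j, [/\ (i + j < b)%N, (`|numq r| < 2 ^ i)%N & (`|denq r| < 2 ^ j)%N].
Proof.
move=> rb; exists (up_log 2 `|numq r|.+1), (up_log 2 `|denq r|.+1).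
by split; [move: rb; rewrite /rat_bits; lia | exact: up_logP..].
Qed.

Lemma common_denominator (T : finType) (f : T -> rat) (b : nat) :
  (forall t, rat_bits (f t) <= b)%N ->
  exists2 D : int, 0 < D /\ (`|D| <= 2 ^ (b * #|T|))%N &
    forall t, exists2 p : int, (`|p| <= 2 ^ (b * #|T|))%N &
      D%:~R * f t = p%:~R.
Proof.
move=> fb.
have [numq_le denq_le] : (forall t, `|numq (f t)| <= 2 ^ b)%N /\
    (forall t, `|denq (f t)| <= 2 ^ b)%N.
  split=> t; have [i [j [ij Ni Dj]]] := rat_bits_split (fb t).
    by apply: leq_trans (ltnW Ni) _; rewrite leq_exp2l //; lia.
  by apply: leq_trans (ltnW Dj) _; rewrite leq_exp2l //; lia.
have le_prod (P : pred T) (g : T -> int) :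
    (forall t, `|g t| <= 2 ^ b)%N ->
    (`|(\prod_(t | P t) g t)%R| <= 2 ^ (b * #|P|))%N.
  move=> gb; rewrite expnM -prod_nat_const.
  rewrite (big_morph absz abszM (erefl : `|1|%N = 1%N)).
  exact: leq_prod.
exists (\prod_t denq (f t)).
  by split; [apply: prodr_gt0|apply: le_prod].
move=> t.
(* Over the product of all denominators, the numerator of [f t] is its own numerator times the other
   denominators: [#|T|] factors, each at most [2 ^ b]. *)
exists (\prod_u (if u == t then numq (f u) else denq (f u))).
  by apply: le_prod => u; case: ifP.
rewrite (bigD1 t) //= [in RHS](bigD1 t) //= eqxx !intrM numqE.
rewrite mulrAC [_ * f t]mulrC; congr (_ * _%:~R).
by apply: eq_bigr => u /negPf ->.
Qed.

(** * Bounded polytopes have no recession directions *)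

Lemma compact_coord_bounded (R : realType) (d : nat) (P : set 'cV[R]_d)
    (l : 'I_d) :
  compact P -> exists M, forall x, P x -> `|x l 0| <= M.
Proof.
move=> cP.
have : compact ((fun x : 'cV[R]_d => x l 0 : R^o) @` P).
  apply: continuous_compact cP.
  by apply: continuous_subspaceT; apply: coord_continuous.
move=> /compact_bounded[M [_ /(_ (M + 1))]]; rewrite ltrDl ltr01 => /(_ isT) PM.
by exists (M + 1) => x Px; apply: (PM (x l 0)); exists x.
Qed.

Lemma compact_polytope_recession (R : realType) (d n : nat)
    (B : 'M[R]_(n, d)) (c : 'cV[R]_n) (x w : 'cV[R]_d) :
  compact (polytope B c) -> polytope B c x ->
  (forall i, (B *m w) i 0 <= 0) -> w = 0.
Proof.
move=> cP Px Bw; apply/colP => l; rewrite mxE.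
apply: contrapT => /eqP wl0.
have [M PM] := compact_coord_bounded l cP.
have M0 : 0 <= M by apply: le_trans (PM _ Px).
(* The ray from [x] along [w] stays in the polytope; this [t] moves coordinate [l] by
   [M + |x l 0| + 1], too far for the bound [M]. *)
pose t := (M + `|x l 0| + 1) / `|w l 0|.
have t0 : 0 <= t by rewrite divr_ge0 // !addr_ge0.
have : `|(x + t *: w) l 0| <= M.
  apply: PM => i; rewrite mulmxDr -scalemxAr !mxE -[leRHS]addr0 lerD //.
    by have := Px i; rewrite !mxE.
  by rewrite mulr_ge0_le0 //; have := Bw i; rewrite !mxE.
have : `|t * w l 0| <= `|x l 0 + t * w l 0| + `|x l 0|.
  by rewrite -[in leLHS](addKr (x l 0) (t * _)) addrC ler_normB.
rewrite !mxE normrM (ger0_norm t0) divfK ?normr_eq0 //; lra.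
Qed.

(** * Averaging along the orbit *)

Lemma mulmx_orbit_sum (R : realType) (d : nat) (A : 'M[R]_d) (x : 'cV[R]_d) N :
  A *m (\sum_(i < N) (A ^+ i *m x)) =
  \sum_(i < N) (A ^+ i *m x) + (A ^+ N *m x - x).
Proof.
elim: N => [|N IHN].
  by rewrite big_ord0 mulmx0 expr0 mul1mx subrr addr0.
rewrite big_ord_recr /= mulmxDr IHN mulmxA exprS -mulmxE.
by rewrite addrA addrAC -!addrA; congr (_ + _); rewrite addrC addrA.
Qed.

(** In the variable [K = 2 * H] the map [H -> 2 * H ^ 2] is plain squaring. *)
Lemma iter_double_square (k H : nat) :
  (2 * iter k (fun H => 2 * H ^ 2) H = (2 * H) ^ (2 ^ k))%N.
Proof.
elim: k => [|k IHk] /=; first by rewrite expn1.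
by rewrite [in RHS]expnSr expnM -IHk expnMn mulnA.
Qed.

(* With [y] the average, [w := A^N x0 / N], [w' := x0 / N] and [delta := 1 / N],
   the system to which [feasible_at0_rat] applies is [B y <= c],
   [B w <= delta c], [B w' <= delta c], [A y - y = w - w'].  At [delta = 0] a
   solution has [w = w' = 0] because the polytope is bounded, so [y] is fixed
   by [A]. *)
Lemma escape_time_bound (R : realType) (d n b : nat)
    (A : 'M[rat]_d) (B : 'M[rat]_(n, d)) (c : 'cV[rat]_n) (x0 : 'cV[R]_d) :
  let AR : 'M[R]_d := map_mx ratr A in
  let BR : 'M[R]_(n, d) := map_mx ratr B in
  let cR : 'cV[R]_n := map_mx ratr c in
  entries_bits_le A b -> entries_bits_le B b -> entries_bits_le c b ->
  compact (polytope BR cR) -> dpep_positive AR BR cR -> polytope BR cR x0 ->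
  exists2 N, (N <= 2 ^ ((b * d.+1 + 2) * 8 ^ d))%N &
    ~ polytope BR cR (AR ^+ N *m x0).
Proof.
move=> AR BR cR Ab Bb cb cP pos Px0; apply: contrapT => stays.
(* This is [(2 * H) ^ (2 ^ (3 * d))] for the height [H = 2 * 2 ^ (b * d.+1)] used below: twice the
   height left after eliminating the [3 * d] variables. *)
set N := (2 ^ ((b * d.+1 + 2) * 8 ^ d))%N in stays.
have orbP i : (i <= N)%N -> polytope BR cR (AR ^+ i *m x0).
  by move=> iN; apply: contrapT => nP; apply: stays; exists i.
have N0 : 0 < N%:R :> R by rewrite ltr0n expn_gt0.
pose delta : R := N%:R^-1.
have delta0 : 0 <= delta by rewrite invr_ge0 ltW.
pose S := \sum_(i < N) (AR ^+ i *m x0).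
pose V := ('I_d + 'I_d + 'I_d)%type.
(* One block of rows for each of the three inequalities; the two copies of ['I_d] express the
   equation as a pair of opposite inequalities. *)
pose I := (('I_n + 'I_n + 'I_n) + ('I_d + 'I_d))%type.
pose fixrow (j : 'I_d) (v : V) : rat :=
  match v with
  | inl (inl l) => A j l - (j == l)%:R
  | inl (inr l) => - (j == l)%:R
  | inr l => (j == l)%:R
  end.
pose a (i : I) (v : V) : rat :=
  match i, v with
  | inl (inl (inl r)), inl (inl l) => B r l
  | inl (inl (inr r)), inl (inr l) => B r l
  | inl (inr r), inr l => B r l
  | inr (inl j), v => fixrow j v
  | inr (inr j), v => - fixrow j v
  | _, _ => 0
  end.
pose c0 (i : I) : rat := if i is inl (inl (inl r)) then c r 0 else 0.
pose c1 (i : I) : rat :=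
  match i with
  | inl (inl (inr r)) => c r 0
  | inl (inr r) => c r 0
  | _ => 0
  end.
pose vec (y w w' : 'cV[R]_d) (v : V) : R :=
  match v with
  | inl (inl l) => y l 0
  | inl (inr l) => w l 0
  | inr l => w' l 0
  end.
have fixrowE y w w' j :
    \sum_v ratr (fixrow j v) * vec y w w' v = (AR *m y - y - w + w') j 0.
  have delta_sum (z : 'cV[R]_d) : \sum_l (j == l)%:R * z l 0 = z j 0.
    rewrite (bigD1 j) //= eqxx mul1r big1 ?addr0 // => l /negPf jl.
    by rewrite eq_sym jl mul0r.
  rewrite !big_sumType /= !mxE; congr (_ + _ + _).
  - rewrite -[y j 0]delta_sum -sumrB; apply: eq_bigr => l _.
    by rewrite mxE rmorphB /= ratr_nat mulrBl.
  - rewrite -[w j 0]delta_sum -sumrN; apply: eq_bigr => l _.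
    by rewrite rmorphN /= ratr_nat mulNr.
  - by rewrite -[w' j 0]delta_sum; apply: eq_bigr => l _; rewrite ratr_nat.
have aE y w w' i : \sum_v ratr (a i v) * vec y w w' v =
    match i with
    | inl (inl (inl r)) => (BR *m y) r 0
    | inl (inl (inr r)) => (BR *m w) r 0
    | inl (inr r) => (BR *m w') r 0
    | inr (inl j) => (AR *m y - y - w + w') j 0
    | inr (inr j) => - (AR *m y - y - w + w') j 0
    end.
  have zero_sum (z : 'I_d -> R) : \sum_l ratr 0 * z l = 0.
    by rewrite big1 // => l _; rewrite rmorph0 mul0r.
  case: i => [[[r|r]|r]|[j|j]].
  - rewrite !big_sumType /= !zero_sum !addr0 mxE.
    by apply: eq_bigr => l _; rewrite mxE.
  - rewrite !big_sumType /= !zero_sum addr0 add0r mxE.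
    by apply: eq_bigr => l _; rewrite mxE.
  - rewrite !big_sumType /= !zero_sum !add0r mxE.
    by apply: eq_bigr => l _; rewrite mxE.
  - exact: fixrowE.
  - rewrite -fixrowE -sumrN; apply: eq_bigr => v _.
    by rewrite /= rmorphN mulNr.
have [z Hz] : exists z : V -> R, forall i,
    \sum_v ratr (a i v) * z v <= ratr (c0 i).
  (* A row of [B] together with its entry of [c] has [d.+1] rationals; the extra factor 2 covers the
     subtraction of the identity from [A]. *)
  pose H := (2 * 2 ^ (b * d.+1))%N.
  apply: (@feasible_at0_rat R V I a c0 c1 H delta
    (vec (delta *: S) (delta *: (AR ^+ N *m x0)) (delta *: x0))) => //.
  - have zero_ok (D : int) :
        exists2 p : int, (`|p| <= H)%N & D%:~R * 0 = p%:~R :> rat.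
      by exists 0; rewrite ?mulr0.
    have rowB r : exists2 D : int, 0 < D &
        (forall l, exists2 p : int, (`|p| <= H)%N & D%:~R * B r l = p%:~R) /\
        exists2 p : int, (`|p| <= H)%N & D%:~R * c r 0 = p%:~R.
      have [|D [D0 _] HD] := @common_denominator (option 'I_d)
          (fun o => if o is Some l then B r l else c r 0) b.
        by case=> [l|]; [apply: Bb|apply: cb].
      rewrite card_option card_ord in HD.
      exists D => //; split=> [l|].
        have [p pH Dp] := HD (Some l); exists p => //.
        by apply: leq_trans pH _; rewrite leq_pmull.
      have [p pH Dp] := HD None; exists p => //.
      by apply: leq_trans pH _; rewrite leq_pmull.
    have rowA j : exists2 D : int, 0 < D &
        forall v, exists2 p : int, (`|p| <= H)%N & D%:~R * fixrow j v = p%:~R.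
      have [D [D0 DH] HD] := common_denominator (fun l => Ab j l).
      have le_bd : (2 ^ (b * #|'I_d|) <= 2 ^ (b * d.+1))%N.
        by rewrite card_ord leq_exp2l // leq_mul.
      have {}DH := leq_trans DH le_bd.
      exists D => //; case=> [[l|l]|l] /=.
      - have [p pH Dp] := HD l; exists (p - D * (j == l)%:R).
          have {}pH := leq_trans pH le_bd.
          by rewrite /H; case: (j == l); lia.
        by rewrite mulrBr Dp intrB intrM; case: (j == l).
      - exists (- D * (j == l)%:R); first by rewrite /H; case: (j == l); lia.
        by rewrite mulrN intrM intrN mulNr; case: (j == l).
      - exists (D * (j == l)%:R); first by rewrite /H; case: (j == l); lia.
        by rewrite intrM; case: (j == l).
    case=> [[[r|r]|r]|[j|j]].
    + have [D D0 [HB Hc]] := rowB r; exists D => //; split=> //.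
      by case=> [[l|l]|l] /=.
    + have [D D0 [HB Hc]] := rowB r; exists D => //; split=> //.
      by case=> [[l|l]|l] /=.
    + have [D D0 [HB Hc]] := rowB r; exists D => //; split=> //.
      by case=> [[l|l]|l] /=.
    + by have [D D0 HA] := rowA j; exists D.
    + have [D D0 HA] := rowA j; exists D => //; split=> // v.
      have [p pH Dp] := HA v; exists (- p); first by rewrite abszN.
      by rewrite /a mulrN Dp intrN.
  - rewrite ltr_pdivrMr // mul1r ltr_nat !card_sum !card_ord.
    have exp8 : (2 ^ (d + d + d) = 8 ^ d)%N.
      by rewrite -[8%N]/(2 ^ 3)%N -expnM; congr (_ ^ _)%N; lia.
    have := iter_double_square (d + d + d) H.
    have -> : ((2 * H) ^ (2 ^ (d + d + d)) = N)%N.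
      by rewrite exp8 /H mulnA -[(2 * 2)%N]/(2 ^ 2)%N -expnD -expnM addnC.
    have : (0 < N)%N by rewrite expn_gt0.
    by lia.
  - move=> i; rewrite aE.
    (* The orbit sum telescopes, so the equality rows hold exactly, with no [delta] term on the
       right. *)
    have fixE : AR *m (delta *: S) - delta *: S - delta *: (AR ^+ N *m x0)
        + delta *: x0 = 0.
      rewrite -scalemxAr mulmx_orbit_sum -!scalerBr -scalerDr.
      by rewrite -/S [S + _]addrC addrK addrAC subrK subrr scaler0.
    have scaleP x : polytope BR cR x ->
        forall r, (BR *m (delta *: x)) r 0 <= delta * ratr (c r 0).
      move=> Px r; rewrite -scalemxAr mxE ler_wpM2l //.
      by have := Px r; rewrite [cR _ _]mxE.
    case: i => [[[r|r]|r]|[j|j]].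
    + rewrite /c0 /c1 rmorph0 mulr0 addr0 -scalemxAr mxE mulmx_sumr summxE.
      rewrite mulrC ler_pdivrMr // mulrC mulr_natl -[in leRHS](card_ord N).
      rewrite -sumr_const; apply: ler_sum => i _.
      by have := orbP i (ltnW (ltn_ord i)) r; rewrite [cR _ _]mxE.
    + by rewrite /c0 rmorph0 add0r scaleP //; apply: orbP.
    + by rewrite /c0 rmorph0 add0r scaleP.
    + by rewrite fixE mxE /c0 /c1 rmorph0 mulr0 addr0.
    + by rewrite fixE mxE oppr0 /c0 /c1 rmorph0 mulr0 addr0.
pose y := \col_l z (inl (inl l)).
pose w := \col_l z (inl (inr l)).
pose w' := \col_l z (inr l).
have {}Hz i : \sum_v ratr (a i v) * vec y w w' v <= ratr (c0 i).
  apply: le_trans (Hz i); rewrite le_eqVlt; apply/orP; left; apply/eqP.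
  by apply: eq_bigr => -[[l|l]|l] _; rewrite /= mxE.
have w0 : w = 0.
  apply: compact_polytope_recession cP Px0 _ => r.
  by have := Hz (inl (inl (inr r))); rewrite aE /= rmorph0.
have w'0 : w' = 0.
  apply: compact_polytope_recession cP Px0 _ => r.
  by have := Hz (inl (inr r)); rewrite aE /= rmorph0.
have Py : polytope BR cR y.
  by move=> r; have := Hz (inl (inl (inl r))); rewrite aE /= [cR _ _]mxE.
have Ay : AR *m y = y.
  apply/eqP; rewrite -subr_eq0; apply/eqP/colP => j; apply/eqP.
  have := Hz (inr (inl j)); have := Hz (inr (inr j)).
  rewrite !aE /= w0 w'0 subr0 addr0 rmorph0 oppr_le0 [in X in _ == X]mxE.
  by move=> ge0 le0; rewrite eq_le ge0 le0.
have [m] := pos _ Py; apply; suff -> : AR ^+ m *m y = y by [].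
by elim: m => [|m IHm]; rewrite ?expr0 ?mul1mx // exprSr -mulmxE -mulmxA Ay.
Qed.

(** * Dimension one: growth of powers and the bound [e^b] *)

(** Since [p / q >= 1 + 1 / q], Bernoulli's inequality gives the factor 2 after [q] steps. *)
Lemma expr_ratio_ge2 (R : realFieldType) (p q : nat) :
  (0 < q < p)%N -> 2 <= (p%:R / q%:R) ^+ q :> R.
Proof.
move=> /andP[q0 qp]; have q0R : 0 < q%:R :> R by rewrite ltr0n.
have bernoulli n : 1 + n%:R / q%:R <= (1 + q%:R^-1) ^+ n :> R.
  elim: n => [|n IHn]; first by rewrite mul0r addr0 expr0.
  have iq0 : 0 < q%:R^-1 :> R by rewrite invr_gt0.
  rewrite exprS -natr1; apply: le_trans (ler_wpM2l _ IHn); last by lra.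
  by rewrite mulrDr mulrDl !mul1r mulr1; have : 0 <= n%:R :> R by []; nra.
apply: le_trans (le_trans _ (bernoulli q)) _; first by rewrite divff ?gt_eqF.
apply: lerXn2r; rewrite ?nnegrE ?addr_ge0 ?divr_ge0 //.
by rewrite ler_pdivlMr // mulrDl mul1r mulVf ?gt_eqF // natr1 ler_nat.
Qed.

(** Compares the escape time [m * (4 * k)] with [e^b] for [b = k.+2]. Squaring reduces it to
    [8 * k ^ 2 * 2 ^ k.+2 <= 5 ^ k.+2], because [e^2 >= (9 / 4)^2 > 5]. *)
Lemma linear_mul_sqrt_exp2_le_expR (R : realType) (k m : nat) :
  (m ^ 2 <= 2 ^ k.+1)%N -> (m * (4 * k))%N%:R <= expR k.+2%:R :> R.
Proof.
move=> m2; have e1 : 9 / 4 <= expR 1 :> R.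
  have -> : 1 = 2^-1 * 2%:R :> R by rewrite mulVf.
  rewrite expRM_natr; have := @expR_ge1Dx R 2^-1; rewrite expr2; nra.
have le5 : (8 * k ^ 2 * 2 ^ k.+2 <= 5 ^ k.+2)%N.
  (* The induction starts at 2, as its step needs [2 * (k + 1)^2 <= 5 * k^2], which fails at 1. *)
  case: k {m2} => [|[|k]] //; elim: k => [|k IHk] //.
  rewrite [(2 ^ k.+4.+1)%N]expnS [(5 ^ k.+4.+1)%N]expnS.
  apply: leq_trans (_ : 5 * (8 * k.+2 ^ 2 * 2 ^ k.+4) <= _)%N.
    by rewrite -!mulnn; nia.
  by rewrite leq_mul2l.
have le_sq : ((m * (4 * k)) ^ 2 <= 5 ^ k.+2)%N.
  apply: leq_trans le5; rewrite expnMn [(2 ^ k.+2)%N]expnS.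
  apply: leq_trans (leq_mul m2 (leqnn _)) _.
  by rewrite -!mulnn; nia.
rewrite -(ler_pXn2r (n := 2)) ?nnegrE ?expR_ge0 //.
rewrite -[k.+2%:R]mul1r expRM_natr -exprM (mulnC k.+2) exprM.
apply: le_trans (_ : 5 ^+ k.+2 <= _); first by rewrite -!natrX ler_nat.
by apply: lerXn2r; rewrite ?nnegrE ?exprn_ge0 ?expR_ge0 //; rewrite expr2; nra.
Qed.

Lemma rat_bits_ge2 (r : rat) : (2 <= rat_bits r)%N.
Proof.
have d0 : (0 < `|denq r|)%N by rewrite absz_gt0 denq_eq0.
have := up_logP `|denq r|.+1 (isT : 1 < 2)%N.
by rewrite /rat_bits; case: up_log => [|k]; rewrite ?expn0; lia.
Qed.

Lemma ratr_absE (R : realFieldType) (r : rat) :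
  `|ratr r| = `|numq r|%N%:R / `|denq r|%N%:R :> R.
Proof.
rewrite -[in LHS](divq_num_den r) fmorph_div /= !ratr_int normf_div.
by rewrite !natr_absz !intr_norm.
Qed.

(** The sign takes one bit, and the numerator and denominator of a nonzero rational at least one
    each, so each of the latter two has at most [k] bits. *)
Lemma rat_bits_bounds (R : realFieldType) (r : rat) (k : nat) :
  r != 0 -> (rat_bits r <= k.+2)%N ->
  `|ratr r| < 2 ^+ k :> R /\ 1 < `|ratr r| * 2 ^+ k :> R.
Proof.
move=> r0 /rat_bits_split[i [j [ijk pi qj]]]; rewrite ratr_absE.
have p0 : (0 < `|numq r|)%N by rewrite absz_gt0 numq_eq0.
have q0 : (0 < `|denq r|)%N by rewrite absz_gt0 denq_eq0.
have i0 : (0 < i)%N by case: i pi {ijk} => //; lia.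
have j0 : (0 < j)%N by case: j qj {ijk} => //; lia.
have pk : (`|numq r| < 2 ^ k)%N.
  by apply: leq_trans pi _; rewrite leq_exp2l //; lia.
have qk : (`|denq r| < 2 ^ k)%N.
  by apply: leq_trans qj _; rewrite leq_exp2l //; lia.
rewrite -natrX ltr_pdivrMr ?ltr0n // mulrAC ltr_pdivlMr ?ltr0n // mul1r.
by rewrite -!natrM !ltr_nat; split; nia.
Qed.

(* In dimension one the bound is only [e^b], so the averaging argument is too
   lossy; instead the orbit [a^m x0] leaves the range of ratio less than
   [2^(4 (b - 2))] allowed by the polytope, as [a] or [1 / a] is at least
   [1 + 1 / m] with [m ^ 2 < 2 ^ (b - 1)]. *)
Lemma escape_time_bound_dim1 (R : realType) (n b : nat)
    (A : 'M[rat]_1) (B : 'M[rat]_(n, 1)) (c : 'cV[rat]_n) (x0 : 'cV[R]_1) :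
  let AR : 'M[R]_1 := map_mx ratr A in
  let BR : 'M[R]_(n, 1) := map_mx ratr B in
  let cR : 'cV[R]_n := map_mx ratr c in
  entries_bits_le A b -> entries_bits_le B b -> entries_bits_le c b ->
  compact (polytope BR cR) -> dpep_positive AR BR cR -> polytope BR cR x0 ->
  exists2 N, N%:R <= expR b%:R :> R & ~ polytope BR cR (AR ^+ N *m x0).
Proof.
move=> AR BR cR Ab Bb cb cP pos Px0.
have [k bE] : exists k, b = k.+2.
  have := leq_trans (rat_bits_ge2 _) (Ab 0 0).
  by case: b {Ab Bb cb} => [|[|k]] // _; exists k.
rewrite bE in Ab Bb cb *.
pose r := A 0 0; pose a : R := ratr r.
have AE m : AR ^+ m *m x0 = a ^+ m *: x0.
  have -> : AR = a%:M by rewrite [AR]mx11_scalar mxE.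
  elim: m => [|m IHm]; first by rewrite !expr0 mul1mx scale1r.
  by rewrite !exprS -mulmxE -mulmxA IHm mul_scalar_mx scalerA.
pose u i := (BR *m x0) i 0.
have uE i : u i = ratr (B i 0) * x0 0 0 by rewrite /u mxE big_ord1 mxE.
have PE t : polytope BR cR (t *: x0) <-> forall i, t * u i <= ratr (c i 0).
  by split=> Pt i; have := Pt i; rewrite -scalemxAr [cR _ _]mxE mxE.
have uc i : u i <= ratr (c i 0) by have := Px0 i; rewrite [cR _ _]mxE.
(* Otherwise the origin, a fixed point, lies in the polytope, against positivity. *)
have [i ci] : exists i, c i 0 < 0.
  apply: contrapT => c_ge0; have [|m] := pos 0.
    move=> i; rewrite mulmx0 !mxE ler0q leNgt; apply/negP => ci.
    by apply: c_ge0; exists i.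
  apply; rewrite mulmx0 => i; rewrite mulmx0 !mxE ler0q leNgt; apply/negP => ci.
  by apply: c_ge0; exists i.
have ciR : ratr (c i 0) < 0 :> R by rewrite ltrq0.
have ui : u i < 0 := le_lt_trans (uc i) ciR.
(* Otherwise [x0] is a recession direction, hence zero, against [u i < 0]. *)
have [j uj] : exists j, 0 < u j.
  apply: contrapT => u_le0; move: ui; rewrite uE.
  rewrite (compact_polytope_recession cP Px0 (w := x0)) ?mxE ?mulr0 ?ltxx //.
  by move=> j; rewrite leNgt; apply/negP => uj; apply: u_le0; exists j.
have cjR : 0 < ratr (c j 0) :> R := lt_le_trans uj (uc j).
(* For [a <= 0] one step makes the left side of row [i] nonnegative, above [c i 0 < 0]. *)
have [a_le0|a_gt0] := leP a 0.
  exists 1%N; first by apply: le_trans (expR_ge1Dx _); rewrite lerDl.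
  rewrite AE expr1 PE => /(_ i); rewrite leNgt => /negP; apply.
  by rewrite (lt_le_trans ciR) // mulr_le0 // ltW.
pose p : R := `|ratr (B i 0)|; pose q : R := `|ratr (B j 0)|.
have Bi0 : B i 0 != 0.
  by apply/eqP => Bi; move: ui; rewrite uE Bi rmorph0 mul0r ltxx.
have Bj0 : B j 0 != 0.
  by apply/eqP => Bj; move: uj; rewrite uE Bj rmorph0 mul0r ltxx.
have pq : q * - u i = p * u j.
  rewrite -(gtr0_norm uj) -(ltr0_norm ui) !uE 2!(normrM _ (x0 0 0)).
  by rewrite mulrCA.
have [p_lt p_gt] := rat_bits_bounds R Bi0 (Bb i 0).
have [q_lt q_gt] := rat_bits_bounds R Bj0 (Bb j 0).
have [_ ci_gt] : `|ratr (c i 0)| < 2 ^+ k :> R /\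
    1 < `|ratr (c i 0)| * 2 ^+ k :> R.
  by apply: rat_bits_bounds => //; rewrite lt_eqF.
have [cj_lt _] : `|ratr (c j 0)| < 2 ^+ k :> R /\
    1 < `|ratr (c j 0)| * 2 ^+ k :> R.
  apply: rat_bits_bounds => //; apply: contraTneq cjR => ->.
  by rewrite rmorph0 ltxx.
rewrite -/p -/q in p_lt p_gt q_lt q_gt.
rewrite (ltr0_norm ciR) in ci_gt; rewrite (gtr0_norm cjR) in cj_lt.
(* Row [i] keeps the absolute value of the point at least [|c i 0| / p], row [j] at most
   [c j 0 / q]. Each of the four rationals costs a factor [2 ^+ k] in the ratio of these limits. *)
have ratio_lt : p * ratr (c j 0) < 2 ^+ (4 * k) * (q * - ratr (c i 0)).
  have p_ge0 : 0 <= p by apply: normr_ge0.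
  have t0 : 0 < 2 ^+ k :> R by rewrite exprn_gt0.
  apply: lt_le_trans (_ : 2 ^+ k * 2 ^+ k <= _).
    by rewrite ltr_pM // ltW.
  have le1 : 1 <= (q * 2 ^+ k) * (- ratr (c i 0) * 2 ^+ k).
    by rewrite -[leLHS]mul1r ler_pM // ltW.
  rewrite mulnC exprM -[leLHS]mulr1.
  apply: le_trans (ler_wpM2l _ le1) _; first by rewrite mulr_ge0 // ltW.
  by rewrite le_eqVlt; apply/orP; left; apply/eqP; ring.
have qc_gt0 : 0 < q * - ratr (c i 0).
  by rewrite mulr_gt0 ?normr_gt0 ?oppr_gt0 // fmorph_eq0.
have pow_le (t : R) m : 2 <= t ^+ m -> 2 ^+ (4 * k) <= t ^+ (m * (4 * k)).
  move=> tm; rewrite (exprM t); apply: lerXn2r; rewrite ?nnegrE //.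
  exact: le_trans tm.
(* Hence the smaller of numerator and denominator has square at most [2 ^ k.+1]; it is the number of
   steps that changes the orbit by a factor 2. *)
have mn_lt : (`|numq r| * `|denq r| <= 2 ^ k.+1)%N.
  have [e [f [ef Ne Df]]] := rat_bits_split (Ab 0 0).
  apply: leq_trans (_ : 2 ^ e * 2 ^ f <= _)%N; first by rewrite leq_mul // ltnW.
  by rewrite -expnD leq_exp2l //; lia.
have aE : a = `|numq r|%N%:R / `|denq r|%N%:R by rewrite -ratr_absE gtr0_norm.
set P := `|numq r|%N in mn_lt aE; set Q := `|denq r|%N in mn_lt aE.
have Q0 : (0 < Q)%N by rewrite absz_gt0 denq_eq0.
have P0 : (0 < P)%N.
  by rewrite lt0n; apply/eqP => P0; move: a_gt0; rewrite aE P0 mul0r ltxx.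
have [PQ|QP|eqPQ] := ltngtP P Q.
(* Contraction, [a < 1]: the orbit falls below the limit set by row [i]. *)
- exists (P * (4 * k))%N.
    apply: linear_mul_sqrt_exp2_le_expR; apply: leq_trans mn_lt.
    by rewrite -mulnn leq_mul // ltnW.
  rewrite AE PE => /(_ i); set N := (P * (4 * k))%N => Ni.
  have aN0 : 0 < a ^+ N by rewrite exprn_gt0.
  have growth : 2 ^+ (4 * k) <= (a ^+ N)^-1.
    rewrite -exprVn; apply: pow_le; rewrite aE invf_div.
    by apply: expr_ratio_ge2; rewrite P0 PQ.
  move: ratio_lt; apply/negP; rewrite -leNgt.
  apply: le_trans (ler_wpM2r (ltW qc_gt0) growth) _.
  rewrite mulrC ler_pdivrMr //.
  have q_ge0 : 0 <= q by apply: normr_ge0.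
  have p_ge0 : 0 <= p by apply: normr_ge0.
  apply: le_trans (_ : q * (- u i * a ^+ N) <= _).
    by apply: ler_wpM2l => //; rewrite mulNr lerN2 mulrC.
  by rewrite mulrA pq ler_wpM2r ?(ltW aN0) // ler_wpM2l.
(* Expansion, [a > 1]: the orbit exceeds the limit set by row [j]. *)
- exists (Q * (4 * k))%N.
    apply: linear_mul_sqrt_exp2_le_expR; apply: leq_trans mn_lt.
    by rewrite -mulnn leq_mul // ltnW.
  rewrite AE PE => /(_ j); set N := (Q * (4 * k))%N => Nj.
  have growth : 2 ^+ (4 * k) <= a ^+ N.
    by apply: pow_le; rewrite aE; apply: expr_ratio_ge2; rewrite Q0 QP.
  move: ratio_lt; apply/negP; rewrite -leNgt.
  apply: le_trans (ler_wpM2r (ltW qc_gt0) growth) _.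
  apply: le_trans (_ : a ^+ N * (q * - u i) <= _).
    rewrite ler_wpM2l ?exprn_ge0 ?(ltW a_gt0) //.
    by rewrite ler_wpM2l ?normr_ge0 // lerN2 uc.
  by rewrite pq mulrCA ler_wpM2l // normr_ge0.
- have [m] := pos _ Px0; case; rewrite AE aE eqPQ divff ?pnatr_eq0 ?gtn_eqF //.
  by rewrite expr1n scale1r.
Qed.

(** * The cases [d = 0], [d = 1] and [d >= 2] *)

Theorem theorem8 (R : realType) :
  exists C : nat,
  forall (d n b : nat)
         (A : 'M[rat]_d) (B : 'M[rat]_(n, d)) (c : 'cV[rat]_n),
    let AR : 'M[R]_d := map_mx ratr A in
    let BR : 'M[R]_(n, d) := map_mx ratr B in
    let cR : 'cV[R]_n := map_mx ratr c in
    entries_bits_le A b -> entries_bits_le B b -> entries_bits_le c b ->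
    compact (polytope BR cR) ->
    dpep_positive AR BR cR ->
    forall x0 : 'cV[R]_d, polytope BR cR x0 ->
      exists N : nat,
        N%:R <= expR (b%:R * d%:R ^+ (C * d)) :> R /\
        ~ polytope BR cR (AR ^+ N *m x0).
Proof.
exists 4%N => -[|[|d]] n b A B c AR BR cR Ab Bb cb cP pos x0 Px0.
(* In dimension 0 there is a single point, which cannot escape, so positivity is contradicted. *)
- have [m] := pos _ Px0; case; suff -> : AR ^+ m *m x0 = x0 by [].
  by apply/colP => -[].
- have [N Nle NP] := escape_time_bound_dim1 Ab Bb cb cP pos Px0.
  by exists N; rewrite expr1n mulr1.
have [N Nle NP] := escape_time_bound Ab Bb cb cP pos Px0.
exists N; split=> //.
have b2 : (2 <= b)%N := leq_trans (rat_bits_ge2 _) (Ab 0 0).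
set e := ((b * d.+3 + 2) * 8 ^ d.+2)%N in Nle.
(* With [D = d.+2 >= 2] and [b >= 2]: [b * (D + 1) + 2 <= b * D^2] and [8^D <= D^(3 D)], while
   [2 + 3 D <= 4 D]; hence [C = 4]. *)
have e_le : (e <= b * d.+2 ^ (4 * d.+2))%N.
  apply: leq_trans (_ : b * d.+2 ^ 2 * (d.+2 ^ 3) ^ d.+2 <= _)%N.
    apply: leq_mul; first by rewrite -mulnn; nia.
    by rewrite leq_exp2r // (leq_exp2r 2 d.+2 (isT : 0 < 3)%N).
  by rewrite -mulnA -expnM -expnD leq_mul2l leq_exp2l //; lia.
apply: le_trans (_ : (2 ^ e)%:R <= _); first by rewrite ler_nat.
apply: le_trans (_ : expR e%:R <= _).
  rewrite natrX -[e%:R]mul1r expRM_natr; apply: lerXn2r.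
  - by rewrite nnegrE.
  - by rewrite nnegrE expR_ge0.
  by apply: le_trans (expR_ge1Dx 1).
by rewrite ler_expR -natrX -natrM ler_nat.
Qed.
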